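(* For every integer $n\geqslant1$, $|\mathrm{PsEnd}(S_n)|=2n^{n-1}+n2^{n-1}-1$.
   Context: For $n\geqslant1$, the star graph $S_n$ is the simple graph with vertex set $\{0,1,\ldots,n-1\}$ and edge set $E=\{\{0,i\}\mid 1\leqslant i\leqslant n-1\}$. For a finite simple graph $G=(V,E)$, $\mathrm{PsEnd}(G)$ is the set of all partial strong endomorphisms of $G$, i.e. partial maps $\alpha:V\to V$ (including the empty one; written on the right) such that for all $u,v\in\mathrm{Dom}(\alpha)$, $\{u,v\}\in E$ if and only if $\{u\alpha,v\alpha\}\in E$. *)

(* Defs.v *)
From mathcomp Require Import all_boot.

Set Implicit Arguments.
Unset Strict Implicit.
Unset Printing Implicit Defensive.

Record sgraph := SGraph {
  svertex :> finType;
  sedge : rel svertex;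
  sedge_sym : symmetric sedge;
  sedge_irr : irreflexive sedge }.

(* A partial map on T is a finite function f : T -> option T, with None outside
   the domain. *)
Definition partial_map (T : finType) := {ffun T -> option T}.

Definition partial_strong_endo (G : sgraph) (f : partial_map G) : bool :=
  [forall u : G, forall v : G, forall u' : G, forall v' : G,
    (f u == Some u') && (f v == Some v') ==> (sedge u v == sedge u' v')].

Definition PsEnd (G : sgraph) : {set partial_map G} :=
  [set f | partial_strong_endo f].

Definition star_edge (n : nat) : rel 'I_n :=
  fun u v => ((u == 0 :> nat) && (0 < v)) || ((v == 0 :> nat) && (0 < u)).

Lemma star_edge_sym n : symmetric (@star_edge n).
Proof. by move=> u v; exact: orbC. Qed.

Lemma star_edge_irr n : irreflexive (@star_edge n).
Proof. by move=> u; rewrite /star_edge orbb; case: (nat_of_ord u). Qed.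

Definition star_graph (n : nat) : sgraph :=
  SGraph (@star_edge_sym n) (@star_edge_irr n).

(* Main.v *)
(** Colour a vertex by whether it is the centre [0]: adjacency in the star means
    having different colours.  Hence a partial map [f] is a strong endomorphism
    iff "[f] changes the colour of [u]" has the same truth value for all [u] in
    the domain.  The maps preserving all colours number [2 * n ^ (n - 1)], those
    changing all colours number [n * 2 ^ (n - 1)], and only the empty map is of
    both kinds. *)
Require Import Defs.
From mathcomp Require Import all_boot.

Lemma star_edge_addb m (u v : 'I_m.+1) :
  star_edge u v = (u == ord0) (+) (v == ord0).
Proof.
by rewrite /star_edge -!val_eqE /= !lt0n; case: eqP; case: eqP.
Qed.

(** The values allowed at [u], with [None] always among them. The condition involves [u] alone, so
    the maps form a [family], counted by a product. *)
Definition recolored {m} (b : bool) (u : 'I_m.+1) : pred (option 'I_m.+1) :=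
  fun o => if o is Some v then (u == ord0) (+) (v == ord0) == b else true.

(** Besides [None], the allowed values are either the centre alone or the [m] leaves. *)
Lemma card_recolored m b (u : 'I_m.+1) :
  #|recolored b u| = if b (+) (u == ord0) then 2 else m.+1.
Proof.
have -> : #|recolored b u|
    = #|[pred v : 'I_m.+1 | (v == ord0) == b (+) (u == ord0)]|.+1.
  rewrite (cardD1 None) (_ : None \in recolored b u) // add1n; congr _.+1.
  rewrite -[RHS](card_image (@Some_inj _)); apply: eq_card => -[v|]; last first.
    by rewrite !inE; apply/esym/imageP => -[].
  rewrite (mem_image (@Some_inj _)) !inE /in_mem /=.
  by case: b (u == _) (v == _) => -[] [].
case: (b (+) _).
  by rewrite (eq_card (B := pred1 ord0)) ?card1 // => v; rewrite !inE eqb_id.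
rewrite (eq_card (B := predC1 ord0)) ?cardC1 ?card_ord // => v.
by rewrite !inE eqbF_neg.
Qed.

Definition recoloring {m} (b : bool) : {set partial_map 'I_m.+1} :=
  [set f in family (recolored b)].

Lemma card_recoloring m b :
  #|@recoloring m b| = if b then m.+1 * 2 ^ m else 2 * m.+1 ^ m.
Proof.
rewrite cardsE card_family foldrE big_map big_enum /=.
under eq_bigr do rewrite card_recolored.
(* The centre gives one factor, the [m] leaves give equal ones. *)
rewrite big_ord_recl eqxx addbT.
under eq_bigr do rewrite addbF.
by rewrite big_const_ord iter_muln_1; case: b.
Qed.

Lemma recoloringI m : @recoloring m false :&: recoloring true = [set [ffun=> None]].
Proof.
apply/setP=> f; rewrite !inE.
apply/andP/eqP => [[/familyP f0 /familyP f1]|->]; last first.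
  by split; apply/familyP=> u; rewrite ffunE.
apply/ffunP=> u; rewrite ffunE; move: (f0 u) (f1 u).
by rewrite /recolored /in_mem /=; case: (f u) => // v /eqP->.
Qed.

Lemma PsEnd_star m :
  PsEnd (star_graph m.+1) = recoloring false :|: recoloring true.
Proof.
apply/setP=> f; rewrite !inE; apply/idP/orP => [/forallP fP | fb].
  (* Over booleans, [u + v = u' + v'] rearranges to [u + u' = v + v']. *)
  have same u v u' v' : f u = Some u' -> f v = Some v' ->
      (u == ord0) (+) (u' == ord0) = (v == ord0) (+) (v' == ord0).
    move=> fu fv; have /forallP/(_ v)/forallP/(_ u')/forallP/(_ v') := fP u.
    rewrite fu fv !eqxx /= !star_edge_addb.
    by case: (u == _) (v == _) (u' == _) (v' == _) => -[] [] [].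
  suff [b fb]: exists b, f \in family (recolored b) by case: b fb; [right | left].
  (* Any vertex of the domain determines [b]. *)
  have [/existsP[u]|] := boolP [exists u, f u != None].
    case fu: (f u) => [u'|] // _.
    exists ((u == ord0) (+) (u' == ord0)); apply/familyP=> v.
    rewrite /recolored /in_mem /=; case fv: (f v) => [v'|] //.
    by rewrite (same _ _ _ _ fu fv).
  (* For the empty map either [b] works; [true] is an arbitrary choice. *)
  rewrite negb_exists => /forallP fN; exists true; apply/familyP=> v.
  by move: (fN v); rewrite negbK => /eqP->.
have {fb}[b /familyP fb]: exists b, f \in family (recolored b).
  by case: fb; [exists false | exists true].
apply/forallP=> u; apply/forallP=> v; apply/forallP=> u'; apply/forallP=> v'.
apply/implyP=> /andP[/eqP fu /eqP fv] /=; rewrite !star_edge_addb.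
move: (fb u) (fb v); rewrite fu fv /recolored /in_mem /=.
by move=> /eqP <-; case: (u == _) (v == _) (u' == _) (v' == _) => -[] [] [].
Qed.

Theorem corollary1p7 (n : nat) (hn : 1 <= n) :
  #|PsEnd (star_graph n)| = 2 * n ^ (n - 1) + n * 2 ^ (n - 1) - 1.
Proof.
case: n hn => // m _; rewrite PsEnd_star cardsU recoloringI cards1.
by rewrite !card_recoloring !subn1.
Qed.
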